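(* Let $\mathrm{BC}$ be the species of bicolored graphs, $S$ the species of split graphs, and $X$ the species of singletons. Then, in the ring of virtual species, $$\mathrm{BC}=\frac{1}{1-X}\cdot S.$$
   Context: Graphs are finite and simple (the graph with no vertices is allowed). A split graph is a graph whose vertices can be partitioned into two (possibly empty) sets $K$ and $S$ such that $K$ is a clique and $S$ is a stable (independent) set. A bicolored graph is a graph in which each vertex is colored green or red such that no two adjacent vertices have the same color; the colors are not interchangeable, and isomorphisms of bicolored graphs are the graph isomorphisms that preserve color. A (combinatorial) species $F$ is a functor from the category of finite sets with bijections to itself: it assigns to each finite set $I$ a finite set $F[I]$ of structures with label set $I$, and to each bijection $\varphi\colon I\to J$ a bijection $F[\varphi]\colon F[I]\to F[J]$, functorially. Isomorphic species (naturally equivalent functors) are regarded as equal. For a species of (possibly colored) graphs of a certain type, $F[I]$ is the set of such graphs with vertex set $I$, and $F[\varphi]$ replaces each label $i$ by $\varphi(i)$ (keeping colors). Sum: $(F+G)[I]=F[I]\sqcup G[I]$. Product: $(F\cdot G)[I]$ is the set of pairs $(f,g)$ with $f\in F[V]$, $g\in G[W]$, over all ordered partitions $I=V\sqcup W$ (parts may be empty). The species $0$ has no structures; the species $1$ has exactly one structure on the empty set and none on nonempty sets. $X$ is the species of singletons: $X[I]=\{I\}$ if $|I|=1$ and $X[I]=\varnothing$ otherwise. The ring of virtual species consists of formal differences $F^+-F^-$ of species, where $F^+-F^-$ and $G^+-G^-$ are identified when the species $F^++G^-$ and $G^++F^-$ are isomorphic; addition and multiplication extend those of species, with $0$ and $1$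 as identities. A virtual species whose part of size $0$ is $1$ or $-1$ is a unit of this ring; for a unit $F$, $1/F$ denotes its multiplicative inverse. (In particular $1-X$ is a unit.) *)

(* Defs.v *)
From HB Require Import structures.
From mathcomp Require Import all_boot boolp.

Set Implicit Arguments.
Unset Strict Implicit.
Unset Printing Implicit Defensive.

Record bij (I J : finType) := Bij {
  bfun :> I -> J;
  binv : J -> I;
  bfunK : cancel bfun binv;
  binvK : cancel binv bfun }.

Lemma bij_eq (I J : finType) (f g : bij I J) : bfun f =1 bfun g -> f = g.
Proof.
case: f g => [f f' fK f'K] [g g' gK g'K] /= /funext efg.
have efg' : f' = g' by apply/funext => y; rewrite -{1}(g'K y) -efg fK.
by case: _ / efg fK f'K gK g'K => fK f'K gK g'K; case: _ / efg' gK g'K => gK g'K;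
   rewrite (Prop_irrelevance fK gK) (Prop_irrelevance f'K g'K).
Qed.

Definition id_bij (I : finType) : bij I I :=
  @Bij I I id id (fun=> erefl) (fun=> erefl).

Definition comp_bij (I J K : finType) (f : bij I J) (g : bij J K) : bij I K :=
  @Bij I K (g \o f) (binv f \o binv g)
    (can_comp (bfunK g) (bfunK f)) (can_comp (binvK f) (binvK g)).

Lemma bij_card (I J : finType) (f : bij I J) : #|I| = #|J|.
Proof. by apply: (bij_eq_card (f := f)); exists (binv f); case: f. Qed.

Definition part (I : finType) (V : {set I}) : finType := {x : I | x \in V}.

Section Restriction.
Variables (I J : finType) (f : bij I J) (V : {set I}) (W : {set J}).
Hypothesis fVW : forall x, (f x \in W) = (x \in V).

Lemma bij_on_fun_subproof (x : part V) : f (val x) \in W.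
Proof. by rewrite fVW (valP x). Qed.

Lemma bij_on_inv_subproof (y : part W) : binv f (val y) \in V.
Proof. by rewrite -fVW binvK (valP y). Qed.

Definition bij_on_fun (x : part V) : part W := exist (fun y => y \in W) _ (bij_on_fun_subproof x).
Definition bij_on_inv (y : part W) : part V := exist (fun x => x \in V) _ (bij_on_inv_subproof y).

Lemma bij_on_funK : cancel bij_on_fun bij_on_inv.
Proof. by move=> x; apply: val_inj; rewrite /= bfunK. Qed.

Lemma bij_on_invK : cancel bij_on_inv bij_on_fun.
Proof. by move=> x; apply: val_inj; rewrite /= binvK. Qed.

Definition bij_on : bij (part V) (part W) := Bij bij_on_funK bij_on_invK.

End Restriction.

Lemma mem_bij_imset (I J : finType) (f : bij I J) (V : {set I}) (x : I) :
  (f x \in f @: V) = (x \in V).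
Proof. exact/mem_imset/can_inj/(bfunK f). Qed.

Lemma mem_bij_imsetC (I J : finType) (f : bij I J) (V : {set I}) (x : I) :
  (f x \in ~: (f @: V)) = (x \in ~: V).
Proof. by rewrite !inE mem_bij_imset. Qed.

Record species := Species {
  structures :> finType -> finType;
  transport : forall I J : finType, bij I J -> structures I -> structures J;
  transport_id : forall (I : finType) (x : structures I),
    transport (id_bij I) x = x;
  transport_comp : forall (I J K : finType) (f : bij I J) (g : bij J K)
      (x : structures I),
    transport (comp_bij f g) x = transport g (transport f x) }.

Definition siso (F G : species) : Prop :=
  exists eta : forall I : finType, F I -> G I,
    (forall I, bijective (eta I)) /\
    (forall (I J : finType) (f : bij I J) (x : F I),
       eta J (transport f x) = transport f (eta I x)).

Definition s0 : species :=
  @Species (fun=> void) (fun _ _ _ x => x) (fun _ _ => erefl)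
    (fun _ _ _ _ _ _ => erefl).

Section OfSize.
Variable n : nat.

Definition of_size_struct (I : finType) : finType := {_ : unit | #|I| == n}.

Lemma of_size_subproof (I J : finType) : bij I J -> #|I| == n -> #|J| == n.
Proof. by move=> /bij_card ->. Qed.

Definition of_size_transport (I J : finType) (f : bij I J)
    (x : of_size_struct I) : of_size_struct J :=
  exist (fun=> #|J| == n) tt (of_size_subproof f (valP x)).

Lemma of_size_irr (I : finType) (x y : of_size_struct I) : x = y.
Proof. by apply: val_inj; case: (val x); case: (val y). Qed.

Definition of_size : species :=
  @Species of_size_struct of_size_transport
    (fun _ _ => of_size_irr _ _) (fun _ _ _ _ _ _ => of_size_irr _ _).
End OfSize.

Definition s1 : species := of_size 0.
Definition sX : species := of_size 1.

Section Sum.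
Variables F G : species.

Definition sadd_struct (I : finType) : finType := (F I + G I)%type.

Definition sadd_transport (I J : finType) (f : bij I J) (x : sadd_struct I) :
    sadd_struct J :=
  match x with inl a => inl (transport f a) | inr b => inr (transport f b) end.

Lemma sadd_transport_id (I : finType) (x : sadd_struct I) :
  sadd_transport (id_bij I) x = x.
Proof. by case: x => x /=; rewrite transport_id. Qed.

Lemma sadd_transport_comp (I J K : finType) (f : bij I J) (g : bij J K)
    (x : sadd_struct I) :
  sadd_transport (comp_bij f g) x = sadd_transport g (sadd_transport f x).
Proof. by case: x => x /=; rewrite transport_comp. Qed.

Definition sadd : species := Species sadd_transport_id sadd_transport_comp.
End Sum.

Section Product.
Variables F G : species.

(** An ordered partition of [I] into two parts is given by its first part. *)
Definition smul_struct (I : finType) : finType :=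
  {V : {set I} & (F (part V) * G (part (~: V)))%type}.

Definition smul_transport (I J : finType) (f : bij I J) (x : smul_struct I) :
    smul_struct J :=
  let: existT V (a, b) := x in
  existT _ (f @: V)
    (transport (bij_on (mem_bij_imset f V)) a,
     transport (bij_on (mem_bij_imsetC f V)) b).

Lemma smul_struct_eq (I : finType) (V V' : {set I})
    (a : F (part V)) (b : G (part (~: V)))
    (a' : F (part V')) (b' : G (part (~: V'))) :
  V = V' ->
  (forall e : bij (part V) (part V'),
     (forall x, val (e x) = val x) -> transport e a = a') ->
  (forall e : bij (part (~: V)) (part (~: V')),
     (forall x, val (e x) = val x) -> transport e b = b') ->
  existT _ V (a, b) = existT _ V' (a', b') :> smul_struct I.
Proof.
move=> eV; case: _ / eV a' b' => a' b' ea eb.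
by rewrite -(ea (id_bij _)) // -(eb (id_bij _)) // !transport_id.
Qed.

Lemma smul_transport_id (I : finType) (x : smul_struct I) :
  smul_transport (id_bij I) x = x.
Proof.
case: x => V [a b]; apply: smul_struct_eq => [|e eE|e eE]; first exact: imset_id.
- rewrite -transport_comp -[RHS]transport_id; congr transport.
  by apply: bij_eq => x; apply: val_inj; rewrite /= eE.
- rewrite -transport_comp -[RHS]transport_id; congr transport.
  by apply: bij_eq => x; apply: val_inj; rewrite /= eE.
Qed.

Lemma smul_transport_comp (I J K : finType) (f : bij I J) (g : bij J K)
    (x : smul_struct I) :
  smul_transport (comp_bij f g) x = smul_transport g (smul_transport f x).
Proof.
case: x => V [a b]; apply: smul_struct_eq => [|e eE|e eE]; first exact: imset_comp.
- rewrite -!transport_comp; congr transport.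
  by apply: bij_eq => x; apply: val_inj; rewrite /= eE.
- rewrite -!transport_comp; congr transport.
  by apply: bij_eq => x; apply: val_inj; rewrite /= eE.
Qed.

Definition smul : species := Species smul_transport_id smul_transport_comp.
End Product.

(** The formal difference [vpos - vneg].  The ring of virtual species is the
    quotient by [veq], used here as a setoid: universe constraints prevent
    [species] from being the carrier of a MathComp algebraic structure. *)
Record virtual := Virtual { vpos : species; vneg : species }.

Definition veq (F G : virtual) : Prop :=
  siso (sadd (vpos F) (vneg G)) (sadd (vpos G) (vneg F)).

Definition virtual_of (F : species) : virtual := Virtual F s0.
Coercion virtual_of : species >-> virtual.

Definition vopp (F : virtual) : virtual := Virtual (vneg F) (vpos F).

Definition vadd (F G : virtual) : virtual :=
  Virtual (sadd (vpos F) (vpos G)) (sadd (vneg F) (vneg G)).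

Definition vsub (F G : virtual) : virtual := vadd F (vopp G).

Definition vmul (F G : virtual) : virtual :=
  Virtual (sadd (smul (vpos F) (vpos G)) (smul (vneg F) (vneg G)))
          (sadd (smul (vpos F) (vneg G)) (smul (vneg F) (vpos G))).

Definition vunit (F : virtual) : Prop := exists G, veq (vmul F G) s1.

(** A chosen inverse of the unit [F]; inverses are unique up to [veq]. *)
Definition vinv (F : virtual) (uF : vunit F) : virtual := projT1 (cid uF).
Arguments vinv : clear implicits.

Lemma vmulV (F : virtual) (uF : vunit F) : veq (vmul F (vinv F uF)) s1.
Proof. exact: projT2 (cid uF). Qed.

Section Graph.
Variable I : finType.

Definition is_graph (E : {set I * I}) : bool :=
  [forall x, (x, x) \notin E] &&
  [forall x, forall y, ((x, y) \in E) == ((y, x) \in E)].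

Definition graph : finType := {E : {set I * I} | is_graph E}.

Definition adj (g : graph) (x y : I) : bool := (x, y) \in val g.

Definition clique (g : graph) (K : {set I}) : bool :=
  [forall x in K, forall y in K, (x != y) ==> adj g x y].

Definition stable (g : graph) (K : {set I}) : bool :=
  [forall x in K, forall y in K, ~~ adj g x y].

Definition is_split (g : graph) : bool :=
  [exists K : {set I}, clique g K && stable g (~: K)].

(** Color [true] is green and color [false] is red. *)
Definition is_bicoloring (g : graph) (c : {ffun I -> bool}) : bool :=
  [forall x, forall y, adj g x y ==> (c x != c y)].

Definition split_graph : finType := {g : graph | is_split g}.

Definition bicolored_graph : finType :=
  {gc : graph * {ffun I -> bool} | is_bicoloring gc.1 gc.2}.
End Graph.

Section Relabel.
Variables (I J : finType) (f : bij I J).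

Definition relabel_edges (E : {set I * I}) : {set J * J} :=
  [set (f p.1, f p.2) | p in E].

Lemma relabel_edgesE (E : {set I * I}) (x y : J) :
  ((x, y) \in relabel_edges E) = ((binv f x, binv f y) \in E).
Proof.
apply/imsetP/idP => [[[a b] Eab [-> ->]]|E1]; first by rewrite !bfunK.
by exists (binv f x, binv f y); rewrite //= !binvK.
Qed.

Lemma relabel_subproof (g : graph I) : is_graph (relabel_edges (val g)).
Proof.
have /andP[/forallP irr /forallP sym] := valP g; apply/andP; split.
  by apply/forallP => x; rewrite relabel_edgesE.
apply/forallP => x; apply/forallP => y; rewrite !relabel_edgesE.
exact: (forallP (sym _)).
Qed.

Definition relabel (g : graph I) : graph J := exist (@is_graph J) _ (relabel_subproof g).

Lemma adj_relabel (g : graph I) (x y : J) :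
  adj (relabel g) x y = adj g (binv f x) (binv f y).
Proof. exact: relabel_edgesE. Qed.

Lemma relabel_split_subproof (g : split_graph I) : is_split (relabel (val g)).
Proof.
have /existsP[K /andP[cK sK]] := valP g; apply/existsP; exists (f @: K).
have KE x : (x \in f @: K) = (binv f x \in K) by rewrite -(mem_bij_imset f) binvK.
apply/andP; split; apply/forall_inP => x xK; apply/forall_inP => y yK;
  rewrite adj_relabel.
- apply/implyP => neq; rewrite !KE in xK yK.
  have /implyP := forall_inP (forall_inP cK _ xK) _ yK; apply.
  by apply: contra neq => /eqP e; rewrite -(binvK f x) e binvK.
- rewrite !in_setC !KE -!in_setC in xK yK.
  exact: forall_inP (forall_inP sK _ xK) _ yK.
Qed.

Definition relabel_split (g : split_graph I) : split_graph J :=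
  exist (@is_split J) _ (relabel_split_subproof g).

Definition relabel_coloring (c : {ffun I -> bool}) : {ffun J -> bool} :=
  [ffun y => c (binv f y)].

Lemma relabel_bicolored_subproof (gc : bicolored_graph I) :
  is_bicoloring (relabel (val gc).1) (relabel_coloring (val gc).2).
Proof.
have gcP := valP gc; apply/forallP => x; apply/forallP => y.
by rewrite adj_relabel !ffunE; apply: (forallP (forallP gcP _)).
Qed.

Definition relabel_bicolored (gc : bicolored_graph I) : bicolored_graph J :=
  exist (fun hc => is_bicoloring hc.1 hc.2) (relabel (val gc).1, relabel_coloring (val gc).2)
    (relabel_bicolored_subproof gc).
End Relabel.

Lemma relabel_id (I : finType) (g : graph I) : relabel (id_bij I) g = g.
Proof. by apply/val_inj/setP => -[x y]; rewrite /= relabel_edgesE. Qed.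

Lemma relabel_comp (I J K : finType) (f : bij I J) (g : bij J K) (h : graph I) :
  relabel (comp_bij f g) h = relabel g (relabel f h).
Proof. by apply/val_inj/setP => -[x y]; rewrite /= !relabel_edgesE. Qed.

Lemma relabel_split_id (I : finType) (g : split_graph I) :
  relabel_split (id_bij I) g = g.
Proof. by apply: val_inj; rewrite /= relabel_id. Qed.

Lemma relabel_split_comp (I J K : finType) (f : bij I J) (g : bij J K)
    (h : split_graph I) :
  relabel_split (comp_bij f g) h = relabel_split g (relabel_split f h).
Proof. by apply: val_inj; rewrite /= relabel_comp. Qed.

Lemma relabel_bicolored_id (I : finType) (g : bicolored_graph I) :
  relabel_bicolored (id_bij I) g = g.
Proof.
apply: val_inj; rewrite /= relabel_id [RHS]surjective_pairing; congr pair.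
by apply/ffunP => x; rewrite ffunE.
Qed.

Lemma relabel_bicolored_comp (I J K : finType) (f : bij I J) (g : bij J K)
    (h : bicolored_graph I) :
  relabel_bicolored (comp_bij f g) h
    = relabel_bicolored g (relabel_bicolored f h).
Proof.
apply: val_inj; rewrite /= relabel_comp; congr pair.
by apply/ffunP => x; rewrite !ffunE.
Qed.

Definition SG : species := Species relabel_split_id relabel_split_comp.
Definition BC : species := Species relabel_bicolored_id relabel_bicolored_comp.

Lemma siso_inv (F G : species) (eta : forall I : finType, F I -> G I) :
  (forall I, bijective (eta I)) ->
  exists h : forall I : finType, G I -> F I,
    forall I, cancel (eta I) (h I) /\ cancel (h I) (eta I).
Proof.
move=> etaB.
have inv_ex (I : finType) : exists h : G I -> F I,
    cancel (eta I) h /\ cancel h (eta I).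
  by have [h hK Kh] := etaB I; exists h.
by exists (fun I => projT1 (cid (inv_ex I))) => I; exact: projT2 (cid (inv_ex I)).
Qed.

Lemma siso_sym (F G : species) : siso F G -> siso G F.
Proof.
move=> [eta [etaB etaN]]; have [h hP] := siso_inv etaB.
exists h; split=> [I|I J f x]; first by have [hK Kh] := hP I; exists (eta I).
by rewrite -{1}((hP I).2 x) -etaN (hP J).1.
Qed.

Lemma siso_trans (F G H : species) : siso F G -> siso G H -> siso F H.
Proof.
move=> [eta [etaB etaN]] [mu [muB muN]]; exists (fun I => mu I \o eta I).
split=> [I|I J f x]; first exact: bij_comp (muB I) (etaB I).
by rewrite /= etaN muN.
Qed.

Lemma inj_surj_bij (A B : finType) (h : A -> B) :
  injective h -> (forall y, exists x, h x = y) -> bijective h.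
Proof.
by move=> hI /choice[g gK]; exists g => // x; apply: hI; rewrite gK.
Qed.

Section LinearOrders.

(** A linear order on [I], as the list of the elements of [I] in order. *)
Definition linear_struct (I : finType) : finType :=
  {s : #|I|.-tuple I | uniq s}.

Definition lseq (I : finType) (s : linear_struct I) : seq I := val s.

Lemma lseq_inj (I : finType) : injective (@lseq I).
Proof. by move=> s t e; do 2!apply: val_inj. Qed.

Lemma size_lseq (I : finType) (s : linear_struct I) : size (lseq s) = #|I|.
Proof. exact: size_tuple. Qed.

Lemma lseq_uniq (I : finType) (s : linear_struct I) : uniq (lseq s).
Proof. exact: valP s. Qed.

Lemma linear_of_seq (I : finType) (s : seq I) :
  uniq s -> size s = #|I| -> {t : linear_struct I | lseq t = s}.
Proof.
by move=> us /eqP ss; exists (exist (fun t : #|I|.-tuple I => uniq t) (Tuple ss) us).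
Qed.

Lemma linear_subproof (I J : finType) (f : bij I J) (s : linear_struct I) :
  uniq (map f (lseq s)) /\ size (map f (lseq s)) = #|J|.
Proof.
rewrite (map_inj_uniq (can_inj (bfunK f))) lseq_uniq size_map size_lseq.
by rewrite (bij_card f).
Qed.

Definition linear_transport (I J : finType) (f : bij I J) (s : linear_struct I) :=
  sval (linear_of_seq (linear_subproof f s).1 (linear_subproof f s).2).

Lemma lseq_transport (I J : finType) (f : bij I J) (s : linear_struct I) :
  lseq (linear_transport f s) = map f (lseq s).
Proof. exact: svalP (linear_of_seq _ _). Qed.

Lemma linear_transport_id (I : finType) (s : linear_struct I) :
  linear_transport (id_bij I) s = s.
Proof. by apply: lseq_inj; rewrite lseq_transport map_id. Qed.

Lemma linear_transport_comp (I J K : finType) (f : bij I J) (g : bij J K)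
    (s : linear_struct I) :
  linear_transport (comp_bij f g) s
    = linear_transport g (linear_transport f s).
Proof. by apply: lseq_inj; rewrite !lseq_transport map_comp. Qed.

Definition linear : species := Species linear_transport_id linear_transport_comp.

Lemma card_part (I : finType) (V : {set I}) : #|part V| = #|V|.
Proof. exact: card_sig. Qed.

Definition pval (I : finType) (V : {set I}) : part V -> I := val.

Lemma pval_inj (I : finType) (V : {set I}) : injective (@pval I V).
Proof. exact: val_inj. Qed.

Section Cons.
Variable n : nat.
Hypothesis n1 : n <= 1.

Definition cons_seq (I : finType) (V : {set I}) (s : linear (part (~: V))) :
    seq I :=
  enum V ++ map (@pval I (~: V)) (lseq s).

Lemma cons_seq_subproof (I : finType) (V : {set I}) (s : linear (part (~: V))) :
  uniq (cons_seq s) /\ size (cons_seq s) = #|I|.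
Proof.
rewrite /cons_seq; split; last first.
  by rewrite size_cat size_map size_lseq card_part -cardE cardsC.
rewrite cat_uniq (map_inj_uniq (@pval_inj _ _)) enum_uniq lseq_uniq /= andbT.
by apply/hasPn => _ /mapP[x _ ->]; rewrite /= mem_enum -in_setC; apply: valP.
Qed.

Definition linear_cons (I : finType) (x : smul (of_size n) linear I) : linear I :=
  let: existT V (_, s) := x in
  sval (linear_of_seq (cons_seq_subproof s).1 (cons_seq_subproof s).2).

Lemma lseq_cons (I : finType) (V : {set I}) (a : of_size n (part V))
    (s : linear (part (~: V))) :
  lseq (linear_cons (existT _ V (a, s))) = cons_seq s.
Proof. exact: svalP (linear_of_seq _ _). Qed.

Lemma size_enum_part (I : finType) (V : {set I}) (a : of_size n (part V)) :
  size (enum V) = n.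
Proof. by rewrite -cardE -card_part (eqP (valP a)). Qed.

Lemma linear_cons_nat (I J : finType) (f : bij I J)
    (x : smul (of_size n) linear I) :
  linear_cons (transport f x) = transport f (linear_cons x).
Proof.
apply: lseq_inj; rewrite [RHS]lseq_transport; case: x => V [a s].
rewrite [transport _ _]/= !lseq_cons /cons_seq lseq_transport map_cat.
congr (_ ++ _); last by rewrite -!map_comp.
have fI := can_inj (bfunK f).
apply: perm_small_eq; first by rewrite size_map (size_enum_part a).
apply: uniq_perm; rewrite ?(map_inj_uniq fI) ?enum_uniq // => y.
rewrite mem_enum; apply/imsetP/mapP => -[x xV ->]; exists x => //.
  by rewrite mem_enum.
by rewrite mem_enum in xV.
Qed.

Lemma linear_cons_inj (I : finType) : injective (@linear_cons I).
Proof.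
move=> [V [a s]] [V' [a' s']] /(congr1 (@lseq I)); rewrite !lseq_cons /cons_seq.
move/eqP; rewrite eqseq_cat ?(size_enum_part a) ?(size_enum_part a') //.
case/andP => /eqP eV /eqP es; apply: smul_struct_eq => [|e _|e eE].
- by apply/setP => x; rewrite -(mem_enum V) eV mem_enum.
- exact: of_size_irr.
- apply: lseq_inj; rewrite lseq_transport; apply: (inj_map (@pval_inj _ _)).
  by rewrite -es -map_comp; apply: eq_map => x; apply: eE.
Qed.

Lemma linear_cons_surj (I : finType) (t : linear I) :
  n <= #|I| -> exists x, linear_cons x = t.
Proof.
move=> nI; have ut := lseq_uniq t; have st := size_lseq t.
set V := [set x in take n (lseq t)].
have szt : size (take n (lseq t)) = n.
  by rewrite size_takel // st.
have cV : #|part V| == n.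
  by rewrite card_part cardsE (card_uniqP _) ?take_uniq ?szt.
have dV : {in drop n (lseq t), forall x, x \in ~: V}.
  move=> x xd; rewrite !inE; apply/negP => xt.
  move: ut; rewrite -(cat_take_drop n (lseq t)) cat_uniq => /and3P[_ /hasPn h _].
  by have := h _ xd; rewrite /= xt.
pose s0 : seq (part (~: V)) := pmap insub (drop n (lseq t)).
have s0E : map (@pval _ _) s0 = drop n (lseq t).
  rewrite (pmap_filter (insubK _)); apply/all_filterP/allP => x /dV xV /=.
  by rewrite insubT.
have [||s sE] := @linear_of_seq _ s0.
- by rewrite -(map_inj_uniq (@pval_inj _ _)) s0E drop_uniq.
- rewrite -(size_map (@pval _ _)) s0E size_drop st card_part.
  by rewrite -(cardsC V) -[#|V|]card_part (eqP cV) addKn.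
exists (existT _ V (exist (fun=> #|part V| == n) tt cV, s)); apply: lseq_inj.
rewrite lseq_cons /cons_seq sE s0E -[RHS](cat_take_drop n); congr (_ ++ _).
apply: perm_small_eq; first by rewrite szt.
apply: uniq_perm; rewrite ?take_uniq ?enum_uniq // => x.
by rewrite mem_enum inE.
Qed.

End Cons.
End LinearOrders.

Lemma linear_cons0 : siso (smul s1 linear) linear.
Proof.
exists (@linear_cons 0); split=> [I|I J f x]; last exact: linear_cons_nat.
by apply: inj_surj_bij => [|t]; [exact: linear_cons_inj|exact: linear_cons_surj].
Qed.

Lemma linear_cons1 : siso (sadd s1 (smul sX linear)) linear.
Proof.
have nil_ok (I : finType) : #|I| == 0 -> uniq (@nil I) /\ size (@nil I) = #|I|.
  by move=> /eqP.
pose nil_lin (I : finType) (a : s1 I) : linear I :=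
  sval (linear_of_seq (nil_ok I (valP a)).1 (nil_ok I (valP a)).2).
have nilE I a : lseq (nil_lin I a) = [::] := svalP (linear_of_seq _ _).
exists (fun I (x : sadd s1 (smul sX linear) I) =>
  match x with inl a => nil_lin I a | inr b => linear_cons b end).
split=> [I|I J f [a|b]].
- apply: inj_surj_bij => [|t].
    have neq (a : s1 I) (b : smul sX linear I) : nil_lin I a <> linear_cons b.
      case: b => V [b s] /(congr1 (@lseq I)); rewrite nilE lseq_cons /cons_seq.
      by have := @size_enum_part 1 _ _ b; case: (enum V) => [|? ?] /=.
    move=> [a|b] [a'|b'] //.
    - by move=> _; congr inl; apply: of_size_irr.
    - by move/neq.
    - by move/esym/neq.
    - by move/linear_cons_inj->.
  have [I0|I0] := posnP #|I|; last first.
    by have [x <-] := linear_cons_surj (leqnn 1) t I0; exists (inr x).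
  have I0' : #|I| == 0 by apply/eqP.
  exists (inl (exist (fun=> #|I| == 0) tt I0')); apply: lseq_inj.
  by rewrite nilE; apply/esym/size0nil; rewrite size_lseq.
- by apply: lseq_inj; rewrite [RHS]lseq_transport !nilE.
- exact: linear_cons_nat.
Qed.

Lemma siso_build (F G : species) (eta : forall I, F I -> G I)
    (mu : forall I, G I -> F I) :
  (forall I, cancel (eta I) (mu I)) -> (forall I, cancel (mu I) (eta I)) ->
  (forall (I J : finType) (f : bij I J) (x : F I),
     eta J (transport f x) = transport f (eta I x)) ->
  siso F G.
Proof. by move=> etaK muK etaN; exists eta; split=> // I; exists (mu I). Qed.

Lemma sadd_cong (F F' G G' : species) :
  siso F F' -> siso G G' -> siso (sadd F G) (sadd F' G').
Proof.
move=> [eta [etaB etaN]] [mu [muB muN]].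
exists (fun I (x : sadd F G I) => match x return sadd F' G' I with
  inl a => inl (eta I a) | inr b => inr (mu I b) end).
split=> [I|I J f [a|b]] /=; [|by rewrite etaN|by rewrite muN].
have [[h hK Kh] [k kK Kk]] := (etaB I, muB I).
exists (fun x : sadd F' G' I => match x return sadd F G I with
  inl a => inl (h a) | inr b => inr (k b) end).
  by case=> a; rewrite ?hK ?kK.
by case=> a; rewrite ?Kh ?Kk.
Qed.

Lemma siso_refl (F : species) : siso F F.
Proof. by apply: (@siso_build _ _ (fun _ x => x) (fun _ x => x)). Qed.

Lemma sadd0 (F : species) : siso (sadd F s0) F.
Proof.
apply: (@siso_build _ _ (fun I (x : sadd F s0 I) =>
  match x with inl a => a | inr b => match b with end end)
  (fun I a => inl a)) => [I|I|I J f] //; by case=> [|[]].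
Qed.

Lemma s0add (F : species) : siso (sadd s0 F) F.
Proof.
apply: (@siso_build _ _ (fun I (x : sadd s0 F I) =>
  match x with inl b => match b with end | inr a => a end)
  (fun I a => inr a)) => [I|I|I J f] //; by case=> [[]|].
Qed.

Lemma smul0 (F : species) : siso (smul F s0) s0.
Proof.
apply: (@siso_build _ _ (fun I (x : smul F s0 I) =>
  let: existT _ (_, b) := x in match b with end)
  (fun I (b : s0 I) => match b with end)) => [I|I|I J f];
by [case=> V [_ []]|case].
Qed.

Lemma smul_cong_l (F F' G : species) :
  siso F F' -> siso (smul F G) (smul F' G).
Proof.
move=> [eta [etaB etaN]].
have [h hP] := siso_inv etaB.
pose u I (x : smul F G I) : smul F' G I :=
  let: existT V (a, b) := x in existT _ V (eta _ a, b).
pose v I (x : smul F' G I) : smul F G I :=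
  let: existT V (a, b) := x in existT _ V (h _ a, b).
apply: (@siso_build _ _ u v) => [I|I|I J f] [V [a b]] /=.
- by rewrite (hP _).1.
- by rewrite (hP _).2.
- by rewrite etaN.
Qed.

Lemma vunit_1X : vunit (vsub s1 sX).
Proof.
exists linear; apply: (@siso_trans _ linear).
  apply: siso_trans (sadd0 _) _; apply: siso_trans linear_cons0.
  apply: siso_trans (sadd_cong (smul_cong_l _ (sadd0 _)) (smul0 _)) (sadd0 _).
apply: siso_sym; apply: siso_trans linear_cons1.
apply: sadd_cong; first exact: siso_refl.
exact: siso_trans (sadd_cong (smul0 _) (smul_cong_l _ (s0add _))) (s0add _).
Qed.

(* Main.v *)
(** Completing the green vertices of a bicolored graph to a clique turns it into
    a split graph [g] with a chosen splitting [K].  Call [w] a swing vertex of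
    [g] if the neighborhood of [w] is itself the clique part of a splitting, so
    that [w] can be on either side.  Any two splittings differ in swing vertices
    only, and the swing vertices form a clique or a stable set; hence the
    splittings of [g] are one neutral splitting together with one exceptional
    splitting for each swing vertex.  On the other hand, [g] with a swing vertex
    [w] is determined by [g - w] with its splitting given by the neighborhood of
    [w].  All this is natural, so [BC] is [S + X * BC], and dividing by [1 - X]
    in the ring of virtual species, where sums of species are cancellative,
    gives the result. *)

From Stdlib Require Import Setoid Ring.
From HB Require Import structures.
From mathcomp Require Import all_boot boolp.
Require Import Defs.

Set Implicit Arguments.
Unset Strict Implicit.
Unset Printing Implicit Defensive.

(** * Cancellation of sums *)

(** Isomorphisms are given below by relations, since the structures involved are presented by
    choices that a function would have to fix. Choice turns a relation that is total and
    single-valued both ways into a bijection, and naturality passes from the relation to it. *)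
Lemma siso_rel (F G : species) (R : forall I : finType, F I -> G I -> Prop) :
  (forall I x, exists y, @R I x y) ->
  (forall I y, exists x, @R I x y) ->
  (forall I x y y', @R I x y -> @R I x y' -> y = y') ->
  (forall I x x' y, @R I x y -> @R I x' y -> x = x') ->
  (forall (I J : finType) (f : bij I J) x y,
     @R I x y -> @R J (transport f x) (transport f y)) ->
  siso F G.
Proof.
move=> Rtot Rsurj Rfun Rinj Rnat.
pose eta I x := projT1 (cid (Rtot I x)).
have etaP I x : R I x (eta I x) := projT2 (cid (Rtot I x)).
exists eta; split=> [I|I J f x]; last exact: Rfun (etaP _ _) (Rnat _ _ _ _ _ (etaP _ _)).
apply: inj_surj_bij => [x x' e|y].
  by apply: Rinj (etaP I x) _; rewrite e; apply: etaP.
by have [x Rxy] := Rsurj I y; exists x; apply: Rfun (etaP _ _) Rxy.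
Qed.

Section Chain.
Variables A B C : Type.

(** Read entry by entry, the equation of lists says that iterating [phi] from [inl a], with the two
    copies of [C] identified, visits the points of [s] in turn and then reaches [w]. *)
Definition chain (phi : A + C -> B + C) (a : A) (s : seq C) (w : B + C) : Prop :=
  map phi (inl a :: map inr s) = rcons (map inr s) w.

Lemma chain_fun phi a s s' b b' :
  chain phi a s (inl b) -> chain phi a s' (inl b') -> b = b'.
Proof.
(* The start is generalized from [inl a] to any point [z], because after one step it has the form
   [inr c]. *)
rewrite /chain; elim: s s' (inl a) => [|c s IHs] [|c' s'] z /=.
- by case=> -> [].
- by case=> -> [].
- by case=> ->.
- by case=> -> e [<- e']; exact: IHs e e'.
Qed.
End Chain.

Lemma chain_rev (A B C : Type) (phi : A + C -> B + C) psi a s b :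
  cancel phi psi -> chain phi a s (inl b) -> chain psi b (rev s) (inl a).
Proof.
rewrite /chain => phiK /(congr1 (fun t => rev (map psi t))).
rewrite -map_comp (eq_map (g := id)) // map_id rev_cons -map_rev => ->.
by rewrite -map_rev rev_rcons -map_rev.
Qed.


(** An orbit that never left [C] could be prolonged forever, and injectivity of [phi] keeps it from
    repeating a point; this contradicts the finiteness of [C]. *)
Lemma chain_total (A B C : finType) (phi : A + C -> B + C) a :
  injective phi -> exists b s, chain phi a s (inl b).
Proof.
move=> phiI; apply: contrapT => noend.
have step n : exists s w, [/\ size s = n, uniq s & chain phi a s w].
  elim: n => [|n [s [w [<- us sP]]]]; first by exists [::], (phi (inl a)).
  case: w sP => [b|c] sP; first by case: noend; exists b, s.
  exists (rcons s c), (phi (inr c)); split; first by rewrite size_rcons.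
    have inrI : injective (@inr B C) by move=> ? ? [].
    (* The prolonged sequence consists of the images under [phi] of [inl a] and of the points of
       [s], which are pairwise distinct. *)
    rewrite -(map_inj_uniq inrI) map_rcons -sP (map_inj_uniq phiI) /=.
    rewrite map_inj_uniq ?us ?andbT; last by move=> ? ? [].
    by apply/mapP => -[].
  by rewrite /chain map_rcons -rcons_cons map_rcons [map phi _]sP -map_rcons.
have [s [w [sz us _]]] := step #|C|.+1.
by have := card_uniqP us; have := max_card (mem s); rewrite sz => /[swap] ->; rewrite ltnn.
Qed.

(* Naturality forbids removing elements of [H] one at a time: the isomorphism
   is iterated until it leaves [H], as in the Garsia-Milne involution principle. *)
Lemma sadd_cancel (F G H : species) : siso (sadd F H) (sadd G H) -> siso F G.
Proof.
move=> [phi [phiB phiN]]; have [psi psiP] := siso_inv phiB.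
have phiK I : cancel (phi I) (psi I) := (psiP I).1.
have psiK I : cancel (psi I) (phi I) := (psiP I).2.
pose R I a b := exists s, @chain (F I) (G I) (H I) (phi I) a s (inl b).
apply: (@siso_rel _ _ R) => [I a|I b|I a b b' [s Rb] [s' Rb']|I a a' b [s Ra] [s' Ra']|I J f a b [s Rab]].
- have [b [s sP]] := chain_total a (can_inj (phiK I)); by exists b, s.
- have [a [s sP]] := chain_total b (can_inj (psiK I)).
  by exists a, (rev s); apply: chain_rev (psiK I) sP.
- exact: chain_fun Rb Rb'.
- exact: chain_fun (chain_rev (phiK I) Ra) (chain_rev (phiK I) Ra').
- exists (map (transport f) s).
  have inrE (K : species) : map inr (map (transport f) s) =
      map (@transport (sadd K H) I J f) (map inr s) by rewrite -!map_comp.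
  rewrite /chain (inrE G).
  transitivity (map (@transport (sadd G H) I J f) (map (phi I) (inl a :: map inr s))).
    rewrite (inrE F) /=; congr cons; first exact: (phiN I J f (inl a)).
    by rewrite -!map_comp; apply: eq_map => x; apply: (phiN I J f (inr x)).
  by rewrite [map (phi I) _]Rab map_rcons.
Qed.

(** * The semiring of species *)

(** The components live in types depending on [V]. Hence [rel] is defined between any two
    structures; it is reflexive through identity bijections, and the equality then yields the
    claim. *)
Lemma smul_structP (F G : species) (I : finType) (V V' : {set I})
    (a : F (part V)) (b : G (part (~: V)))
    (a' : F (part V')) (b' : G (part (~: V'))) :
  existT _ V (a, b) = existT _ V' (a', b') :> smul F G I ->
  (exists2 e : bij (part V) (part V'),
     (forall x, val (e x) = val x) & transport e a = a') /\
  (exists2 e : bij (part (~: V)) (part (~: V')),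
     (forall x, val (e x) = val x) & transport e b = b').
Proof.
pose rel (x y : smul F G I) : Prop :=
  (exists2 e : bij (part (projT1 x)) (part (projT1 y)),
     (forall x, val (e x) = val x) & transport e (projT2 x).1 = (projT2 y).1) /\
  (exists2 e : bij (part (~: (projT1 x))) (part (~: (projT1 y))),
     (forall x, val (e x) = val x) & transport e (projT2 x).2 = (projT2 y).2).
have relxx x : rel x x.
  by split; exists (id_bij _); rewrite // transport_id.
have rel_eq x y : x = y -> rel x y by move=> ->.
exact: rel_eq.
Qed.

Lemma bij_of_fun (A J : finType) (h : A -> J) :
  injective h -> (forall y, exists x, h x = y) -> {u : bij A J | bfun u =1 h}.
Proof.
move=> hI hS; apply: cid; have [k hK kK] := inj_surj_bij hI hS.
by exists (Bij hK kK).
Qed.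

Lemma bij_part (A I : finType) (h : A -> I) (V : {set I}) :
  injective h -> (forall i, i \in V <-> exists a, h a = i) ->
  {u : bij A (part V) | forall a, val (u a) = h a}.
Proof.
move=> hI hV; have hin a : h a \in V by apply/hV; exists a.
have [||u uE] := @bij_of_fun A (part V) (fun a => exist (fun i => i \in V) (h a) (hin a)).
- by move=> a a' [/hI].
- by move=> [i iV]; have [a aE] := (hV i).1 iV; exists a; apply: val_inj.
- by exists u => a; rewrite uE.
Qed.

Definition inv_bij (I J : finType) (f : bij I J) : bij J I :=
  Bij (binvK f) (bfunK f).

Lemma bij_inj (I J : finType) (f : bij I J) : injective f.
Proof. exact: can_inj (bfunK f). Qed.

Lemma transport_ext (F : species) (I J : finType) (f g : bij I J) (x : F I) :
  f =1 g -> transport f x = transport g x.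
Proof. by move=> /bij_eq ->. Qed.

Section SumBij.
Variables A B A' B' : finType.

Definition sum_bij (u : bij A A') (v : bij B B') : bij (A + B)%type (A' + B')%type.
Proof.
refine (@Bij (A + B)%type (A' + B')%type
  (fun x => match x with inl a => inl (u a) | inr b => inr (v b) end)
  (fun x => match x with inl a => inl (binv u a) | inr b => inr (binv v b) end) _ _).
- by case=> x; rewrite bfunK.
- by case=> x; rewrite binvK.
Defined.

Definition swap_bij : bij (A + B)%type (B + A)%type.
Proof.
refine (@Bij (A + B)%type (B + A)%type
  (fun x => match x with inl a => inr a | inr b => inl b end)
  (fun x => match x with inl a => inr a | inr b => inl b end) _ _); by case.
Defined.

Definition assoc_bij : bij (A + (B + A'))%type ((A + B) + A')%type.
Proof.
refine (@Bij (A + (B + A'))%type ((A + B) + A')%type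
  (fun x => match x with inl a => inl (inl a) | inr (inl b) => inl (inr b)
                       | inr (inr c) => inr c end)
  (fun x => match x with inl (inl a) => inl a | inl (inr b) => inr (inl b)
                       | inr c => inr (inr c) end) _ _); [by move=> [a|[b|c]]|by move=> [[a|b]|c]].
Defined.
End SumBij.

Section Mk.
Variables F G : species.

Section Def.
Variables A B I : finType.
Variable e : bij (A + B)%type I.

Definition mk_set : {set I} := [set e (inl a) | a : A].

Lemma mk_setP i : i \in mk_set <-> exists a, e (inl a) = i.
Proof. by split=> [/imsetP[a _ ->]|[a <-]]; [exists a|apply/imsetP; exists a]. Qed.

Lemma mk_setCP i : i \in ~: mk_set <-> exists b, e (inr b) = i.
Proof.
rewrite in_setC; split=> [/negP iV|[b <-]]; last first.
  by apply/negP => /mk_setP[a /bij_inj].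
rewrite -(binvK e i) in iV *; case: (binv e i) iV => [a|b] iV; last by exists b.
by case: iV; apply/mk_setP; exists a.
Qed.

Lemma inl_bij_inj : injective (fun a => e (inl a)).
Proof. by move=> a a' /bij_inj[]. Qed.

Lemma inr_bij_inj : injective (fun b => e (inr b)).
Proof. by move=> b b' /bij_inj[]. Qed.

Definition mk_l := bij_part inl_bij_inj mk_setP.
Definition mk_r := bij_part inr_bij_inj mk_setCP.

(* Lets the two parts of a product structure be arbitrary label sets, so that
   iterated products do not involve subsets of subsets. *)
Definition mk (a : F A) (b : G B) : smul F G I :=
  existT _ mk_set (transport (sval mk_l) a, transport (sval mk_r) b).
End Def.

(** A presentation of a product structure is unique up to relabelling its two parts separately. The
    bijections [u] and [v] are the identifications of the parts inside [I], conjugated by [mk_l] and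
    [mk_r]. *)
Lemma mk_eqP (A B A' B' I : finType) (e : bij (A + B)%type I)
    (e' : bij (A' + B')%type I) a b a' b' :
  mk e a b = mk e' a' b' <->
  exists (u : bij A A') (v : bij B B'),
    [/\ forall x, e x = e' (sum_bij u v x), transport u a = a' & transport v b = b'].
Proof.
split.
  case/smul_structP => -[u uE ua] [v vE vb].
  exists (comp_bij (sval (mk_l e)) (comp_bij u (inv_bij (sval (mk_l e'))))).
  exists (comp_bij (sval (mk_r e)) (comp_bij v (inv_bij (sval (mk_r e'))))).
  split.
  - case=> [x|x] /=.
    + by rewrite -(svalP (mk_l e')) binvK uE (svalP (mk_l e)).
    + by rewrite -(svalP (mk_r e')) binvK vE (svalP (mk_r e)).
  - rewrite 2!transport_comp ua -transport_comp -[RHS]transport_id.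
    by apply: transport_ext => x /=; rewrite bfunK.
  - rewrite 2!transport_comp vb -transport_comp -[RHS]transport_id.
    by apply: transport_ext => x /=; rewrite bfunK.
move=> [u [v [eE <- <-]]]; apply: smul_struct_eq => [|w wE|w wE].
- apply/setP => i; apply/idP/idP => /mk_setP[x <-]; apply/mk_setP.
    by exists (u x); rewrite eE.
  by exists (binv u x); rewrite eE /= binvK.
- rewrite -!transport_comp; apply: transport_ext => x; apply: val_inj.
  by rewrite /= wE (svalP (mk_l e)) (svalP (mk_l e')) eE.
- rewrite -!transport_comp; apply: transport_ext => x; apply: val_inj.
  by rewrite /= wE (svalP (mk_r e)) (svalP (mk_r e')) eE.
Qed.

Lemma mk_transport (A B I J : finType) (e : bij (A + B)%type I) (f : bij I J) a b :
  transport f (mk e a b) = mk (comp_bij e f) a b.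
Proof.
apply: smul_struct_eq => [|w wE|w wE].
- by rewrite -imset_comp.
- rewrite -!transport_comp; apply: transport_ext => x; apply: val_inj.
  by rewrite /= wE /= (svalP (mk_l e)) (svalP (mk_l _)).
- rewrite -!transport_comp; apply: transport_ext => x; apply: val_inj.
  by rewrite /= wE /= (svalP (mk_r e)) (svalP (mk_r _)).
Qed.

Lemma mk_surj (I : finType) (x : smul F G I) :
  exists (A B : finType) (e : bij (A + B)%type I) a b, x = mk e a b.
Proof.
case: x => V [a b]; exists (part V), (part (~: V)).
pose h (z : part V + part (~: V)) := match z with inl x => val x | inr y => val y end.
have [||e eE] := @bij_of_fun (part V + part (~: V))%type I h.
- have dis (z : part V) (z' : part (~: V)) : val z <> val z'.
    by move=> zz'; have := valP z'; rewrite in_setC -zz' (valP z).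
  move=> [z|z] [z'|z'] /=; [|by move/dis|by move/esym/dis|]; by move/val_inj ->.
- move=> i; case: (boolP (i \in V)) => iV.
    by exists (inl (exist (fun i => i \in V) i iV)).
  rewrite -in_setC in iV; by exists (inr (exist (fun i => i \in ~: V) i iV)).
exists e, a, b; apply: smul_struct_eq => [|w wE|w wE].
- apply/setP => i; apply/idP/idP => [iV|/mk_setP[x <-]]; last by rewrite eE; apply: valP.
  by apply/mk_setP; exists (exist (fun i => i \in V) i iV); rewrite eE.
- apply: transport_ext => x; apply: val_inj.
  by rewrite wE (svalP (mk_l e)) eE.
- apply: transport_ext => x; apply: val_inj.
  by rewrite wE (svalP (mk_r e)) eE.
Qed.
End Mk.

(** * Laws of the product and of the sum *)

Definition void_bij (I : finType) : bij (void + I)%type I.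
Proof.
refine (@Bij (void + I)%type I
  (fun x => match x with inl a => match a with end | inr i => i end)
  (fun i => inr i) _ _) => //; by case.
Defined.

Lemma card_void0 : #|{: void}| == 0.
Proof. by rewrite card_void. Qed.

Lemma s1mul (F : species) : siso (smul s1 F) F.
Proof.
pose t0 : s1 void := exist (fun=> #|{: void}| == 0) tt card_void0.
apply: siso_sym; apply: (@siso_rel _ _ (fun I y x => x = mk (void_bij I) t0 y)).
- by move=> I y; exists (mk (void_bij I) t0 y).
- move=> I x; have [A [B [e [a [b ->]]]]] := mk_surj x.
  have A0 (z : A) : False by have := card0_eq (eqP (valP a)) z.
  have [||v vE] := @bij_of_fun B I (fun z => e (inr z)).
  + by move=> z z' /bij_inj[].
  + move=> i; rewrite -(binvK e i); case: (binv e i) => z; first by case: (A0 z).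
    by exists z.
  have [||u uE] := @bij_of_fun A void (fun z => match A0 z return void with end).
  + by move=> z; case: (A0 z).
  + by case.
  exists (transport v b); apply/mk_eqP; exists u, v; split=> //.
  + by case=> z /=; [case: (A0 z)|rewrite vE].
  + exact: of_size_irr.
- by move=> I y x x' -> ->.
- move=> I y y' x -> /mk_eqP[u [v [vE _ <-]]].
  rewrite -[LHS]transport_id; apply: transport_ext => i.
  exact: (vE (inr i)).
- move=> I J f y x ->; rewrite mk_transport; apply/mk_eqP.
  exists (id_bij _), f; split=> //; first by case.
  exact: transport_id.
Qed.

Lemma smulC (F G : species) : siso (smul F G) (smul G F).
Proof.
(* This relation is symmetric, as swapping twice is the identity; so its totality and
   single-valuedness in one direction give them in the other. *)
pose R (F G : species) I x y := exists (A B : finType) (e : bij (A + B)%type I) (a : F A) (b : G B),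
  x = mk e a b /\ y = mk (comp_bij (swap_bij B A) e) b a.
have Rsym F' G' I x y : R F' G' I x y -> R G' F' I y x.
  move=> [A [B [e [a [b [-> ->]]]]]].
  exists B, A, (comp_bij (swap_bij B A) e), b, a; split=> //.
  by congr mk; apply: bij_eq; case.
have Rtot F' G' I x : exists y, R F' G' I x y.
  have [A [B [e [a [b ->]]]]] := mk_surj x.
  by eexists; exists A, B, e, a, b.
have Rfun F' G' I x y y' : R F' G' I x y -> R F' G' I x y' -> y = y'.
  move=> [A [B [e [a [b [-> ->]]]]]] [A' [B' [e' [a' [b' [/mk_eqP h ->]]]]]].
  have [u [v [eE ua vb]]] := h; apply/mk_eqP; exists v, u; split=> //.
  by case=> z /=; rewrite eE.
apply: (@siso_rel _ _ (@R F G)) => [I x|I y|I x y y'|I x x' y|I J f x y].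
- exact: Rtot.
- by have [x /Rsym Rxy] := Rtot _ _ _ y; exists x.
- exact: Rfun.
- by move=> /Rsym h /Rsym h'; apply: Rfun h h'.
- move=> [A [B [e [a [b [-> ->]]]]]].
  exists A, B, (comp_bij e f), a, b; rewrite !mk_transport; split=> //.
  by congr mk; apply: bij_eq.
Qed.

(** The bijection presenting the inner product is absorbed into the outer one, which leaves three
    label sets and a single bijection [e]. *)
Lemma mk_flatten_l (F G H : species) (I : finType) (x : smul (smul F G) H I) :
  exists (A B C : finType) (e : bij ((A + B) + C)%type I) a b c,
    x = mk e (mk (id_bij _) a b) c.
Proof.
have [D [C [e [d [c ->]]]]] := mk_surj x; have [A [B [w [a [b ->]]]]] := mk_surj d.
exists A, B, C, (comp_bij (sum_bij w (id_bij C)) e), a, b, c; apply/mk_eqP.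
exists (inv_bij w), (id_bij C); split; last exact: transport_id.
  by case=> z //=; rewrite binvK.
by rewrite mk_transport; congr mk; apply: bij_eq => z /=; rewrite bfunK.
Qed.

Lemma mk_flatten_r (F G H : species) (I : finType) (x : smul F (smul G H) I) :
  exists (A B C : finType) (e : bij (A + (B + C))%type I) a b c,
    x = mk e a (mk (id_bij _) b c).
Proof.
have [A [D [e [a [d ->]]]]] := mk_surj x; have [B [C [w [b [c ->]]]]] := mk_surj d.
exists A, B, C, (comp_bij (sum_bij (id_bij A) w) e), a, b, c; apply/mk_eqP.
exists (id_bij A), (inv_bij w); split; [|exact: transport_id|].
  by case=> z //=; rewrite binvK.
by rewrite mk_transport; congr mk; apply: bij_eq => z /=; rewrite bfunK.
Qed.

Lemma smulA (F G H : species) : siso (smul F (smul G H)) (smul (smul F G) H).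
Proof.
(* Both bracketings are presented by the same three structures and the same [e], up to reassociating
   the disjoint sum. *)
pose R I x y := exists (A B C : finType) (e : bij ((A + B) + C)%type I)
    (a : F A) (b : G B) (c : H C),
  x = mk (comp_bij (assoc_bij A B C) e) a (mk (id_bij _) b c) /\
  y = mk e (mk (id_bij _) a b) c.
apply: (@siso_rel _ _ R) => [I x|I y|I x y y'|I x x' y|I J f x y].
- have [A [B [C [e [a [b [c ->]]]]]]] := mk_flatten_r x.
  eexists; exists A, B, C, (comp_bij (inv_bij (assoc_bij A B C)) e), a, b, c.
  split=> //; congr mk; apply: bij_eq => z.
  by rewrite -[in LHS](bfunK (assoc_bij A B C) z).
- have [A [B [C [e [a [b [c ->]]]]]]] := mk_flatten_l y.
  by eexists; exists A, B, C, e, a, b, c.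
- move=> [A [B [C [e [a [b [c [-> ->]]]]]]]] [A' [B' [C' [e' [a' [b' [c' [h ->]]]]]]]].
  have [u [v [eE ua]]] := (mk_eqP _ _ _ _ _ _).1 h.
  rewrite mk_transport => /mk_eqP[v1 [v2 [vE vb vc]]].
  apply/mk_eqP; exists (sum_bij u v1), v2; split=> //; last first.
    rewrite mk_transport; apply/mk_eqP.
    by exists u, v1; split=> //; case.
  case=> [[z|z]|z].
  + exact: (eE (inl z)).
  + by have := eE (inr (inl z)); rewrite /= (vE (inl z)).
  + by have := eE (inr (inr z)); rewrite /= (vE (inr z)).
- move=> [A [B [C [e [a [b [c [-> ->]]]]]]]] [A' [B' [C' [e' [a' [b' [c' [-> h]]]]]]]].
  have [u [v [eE]]] := (mk_eqP _ _ _ _ _ _).1 h.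
  rewrite mk_transport => /mk_eqP[u1 [u2 [uE ua ub]]] vc.
  apply/mk_eqP; exists u1, (sum_bij u2 v); split=> //; last first.
    rewrite mk_transport; apply/mk_eqP.
    by exists u2, v; split=> //; case.
  case=> [z|[z|z]].
  + by have := eE (inl (inl z)); rewrite /= (uE (inl z)).
  + by have := eE (inl (inr z)); rewrite /= (uE (inr z)).
  + exact: (eE (inr z)).
- move=> [A [B [C [e [a [b [c [-> ->]]]]]]]].
  exists A, B, C, (comp_bij e f), a, b, c; rewrite !mk_transport; split=> //.
  by congr mk; apply: bij_eq.
Qed.

Lemma saddC (F G : species) : siso (sadd F G) (sadd G F).
Proof.
pose swap (F G : species) I (x : sadd F G I) : sadd G F I :=
  match x with inl a => inr a | inr b => inl b end.
by apply: (@siso_build _ _ (@swap F G) (@swap G F)) => [I|I|I J f]; case.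
Qed.

Lemma saddA (F G H : species) : siso (sadd F (sadd G H)) (sadd (sadd F G) H).
Proof.
apply: (@siso_build (sadd F (sadd G H)) (sadd (sadd F G) H)
  (fun I => bfun (assoc_bij (F I) (G I) (H I)))
  (fun I => binv (assoc_bij (F I) (G I) (H I)))) => [I|I|I J f].
- exact: bfunK.
- exact: binvK.
- by case=> [|[]].
Qed.

Lemma smulDl (F G H : species) :
  siso (smul (sadd F G) H) (sadd (smul F H) (smul G H)).
Proof.
apply: (@siso_build _ _
  (fun I (x : smul (sadd F G) H I) => match x return sadd (smul F H) (smul G H) I with
     | existT V (inl a, c) => inl (existT _ V (a, c))
     | existT V (inr b, c) => inr (existT _ V (b, c)) end)
  (fun I (x : sadd (smul F H) (smul G H) I) => match x return smul (sadd F G) H I with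
     | inl (existT V (a, c)) => existT _ V (inl a, c)
     | inr (existT V (b, c)) => existT _ V (inr b, c) end)) => [I|I|I J f].
- by case=> V [[a|b] c].
- by case=> [[V [a c]]|[V [b c]]].
- by case=> V [[a|b] c].
Qed.

Lemma s0mul (F : species) : siso (smul s0 F) s0.
Proof. exact: siso_trans (smulC _ _) (smul0 _). Qed.

Lemma smul_cong (F F' G G' : species) :
  siso F F' -> siso G G' -> siso (smul F G) (smul F' G').
Proof.
move=> FF' GG'; apply: siso_trans (smul_cong_l G FF') _.
apply: siso_trans (smulC _ _) _; apply: siso_trans (smulC _ _).
exact: smul_cong_l.
Qed.

Add Parametric Relation : species siso
  reflexivity proved by siso_refl symmetry proved by siso_sym
  transitivity proved by siso_trans as siso_setoid.
Add Parametric Morphism : sadd with signature siso ==> siso ==> siso as sadd_morphism.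
Proof. by move=> F F' FF' G G' GG'; apply: sadd_cong. Qed.
Add Parametric Morphism : smul with signature siso ==> siso ==> siso as smul_morphism.
Proof. by move=> F F' FF' G G' GG'; apply: smul_cong. Qed.

Lemma species_semiring : semi_ring_theory s0 s1 sadd smul siso.
Proof.
split.
- exact: s0add.
- exact: saddC.
- exact: saddA.
- exact: s1mul.
- exact: s0mul.
- exact: smulC.
- exact: smulA.
- exact: smulDl.
Qed.

Add Ring species_ring : species_semiring.

(** * Division by [1 - X] *)

Lemma veq_div_1X (S B : species) (u : vunit (vsub s1 sX)) :
  siso B (sadd S (smul sX B)) -> veq B (vmul (vinv (vsub s1 sX) u) S).
Proof.
move=> BS; have := vmulV u; case: (vinv _ u) => P N; rewrite /veq /= => PN.
(* Here [PN] says [P + X N = 1 + N + X P], and the goal is [B + N S = P S]. With [X P B + X N B]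
   added, [BS] collapses [N S + X N B] to [N B] and [P S + X P B] to [P B], which leaves
   [(1 + N + X P) B = (P + X N) B]. *)
apply: (@sadd_cancel _ _ (sadd (smul sX (smul P B)) (smul sX (smul N B)))).
transitivity (sadd (smul N (sadd S (smul sX B))) (sadd B (smul (smul sX P) B))); first by ring.
rewrite -BS.
transitivity (sadd (smul P (sadd S (smul sX B))) (smul (smul sX N) B)); last by ring.
rewrite -BS.
(* The intermediate term reproduces the left side of [PN] literally, zeros included, so that [PN]
   can be rewritten in it. *)
symmetry; transitivity (smul (sadd (sadd (smul (sadd s1 s0) P) (smul (sadd s0 sX) N)) s0) B).
  by ring.
rewrite PN; ring.
Qed.

(** * Splittings and swing vertices *)

Section GraphTheory.
Variable I : finType.
Implicit Types (g : graph I) (K : {set I}).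

Lemma adjC g x y : adj g x y = adj g y x.
Proof. by have /andP[_ /forallP/(_ x)/forallP/(_ y)/eqP] := valP g. Qed.

Lemma adjxx g x : adj g x x = false.
Proof. by have /andP[/forallP/(_ x)/negbTE] := valP g. Qed.

Lemma graph_ext g g' : adj g =2 adj g' -> g = g'.
Proof. by move=> e; apply/val_inj/setP => -[x y]; apply: e. Qed.

Lemma graph_of_rel (r : rel I) : symmetric r ->
  {g | forall x y, adj g x y = (x != y) && r x y}.
Proof.
move=> rC; pose E := [set p : I * I | (p.1 != p.2) && r p.1 p.2].
have Eg : is_graph E.
  apply/andP; split; apply/forallP => x; first by rewrite inE eqxx.
  by apply/forallP => y; rewrite !inE /= [x == y]eq_sym [r x y]rC.
by exists (exist (@is_graph I) E Eg) => x y; rewrite /adj inE.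
Qed.

Lemma cliqueP g K :
  reflect {in K &, forall x y, x != y -> adj g x y} (clique g K).
Proof.
apply: (iffP forall_inP) => [h x y xK yK|h x xK].
  by apply/implyP; apply: (forall_inP (h x xK)).
by apply/forall_inP => y yK; apply/implyP; apply: h.
Qed.

Lemma stableP g K : reflect {in K &, forall x y, adj g x y = false} (stable g K).
Proof.
apply: (iffP forall_inP) => [h x y xK yK|h x xK].
  by apply/negbTE; apply: (forall_inP (h x xK)).
by apply/forall_inP => y yK; rewrite h.
Qed.

Definition ks g K : bool := clique g K && stable g (~: K).

Lemma ksP g K : reflect
  (forall x y, (x \in K -> y \in K -> x != y -> adj g x y) /\
     (x \notin K -> y \notin K -> adj g x y = false)) (ks g K).
Proof.
apply: (iffP andP) => [[/cliqueP cK /stableP sK] x y|h].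
  split; first exact: cK.
  by rewrite -!in_setC; apply: sK.
split; [apply/cliqueP|apply/stableP] => x y; first by apply: (h x y).1.
by rewrite !in_setC; apply: (h x y).2.
Qed.

Lemma ks_clique g K x y : ks g K -> x \in K -> y \in K -> x != y -> adj g x y.
Proof. by move=> /ksP/(_ x y)[]. Qed.

Lemma ks_stable g K x y : ks g K -> x \notin K -> y \notin K -> adj g x y = false.
Proof. by move=> /ksP/(_ x y)[]. Qed.

Definition nbh g w : {set I} := [set x | adj g w x].

Definition swing g w : bool := ks g (nbh g w).

Definition swings g : {set I} := [set w | swing g w].

Lemma swing_ks_nbh1 g w : swing g w -> ks g (w |: nbh g w).
Proof.
move=> sw; apply/ksP => x y; rewrite !inE !negb_or; split.
  case/predU1P => [->|wx] /predU1P[->|wy]; rewrite ?eqxx // 1?adjC //.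
  by move=> xy; rewrite adjC; apply: (ks_clique sw); rewrite ?inE.
by case/andP=> _ wx /andP[_ wy]; apply: (ks_stable sw); rewrite inE.
Qed.

(** Since [x] is outside [K'], its neighbors lie in [K'] and form a clique. For two non-neighbors,
    [half] treats the case where one of them is in [K']: it is then outside [K], so a vertex
    adjacent to it lies in [K] and is [x] or a neighbor of [x], a contradiction. If both are outside
    [K'], they are not adjacent. *)
Lemma swing_diff g K K' x : ks g K -> ks g K' -> x \in K -> x \notin K' -> swing g x.
Proof.
move=> kK kK' xK xK'; have NK y : adj g x y -> y \in K'.
  by move=> xy; apply: contraTT xy => yK'; rewrite (ks_stable kK').
apply/ksP => a b; rewrite !inE; split.
  by move=> /NK aK' /NK bK'; apply: ks_clique kK' _ _.
have half a' b' : ~~ adj g x a' -> ~~ adj g x b' -> a' \in K' -> adj g a' b' = false.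
  move=> xa xb aK'; apply: contraNF xa => ab.
  have xa' : x != a' by apply: contraNneq xK' => ->.
  have [aK|aK] := boolP (a' \in K); first exact: ks_clique kK _ _ _.
  have bK : b' \in K by apply: contraTT ab => bK; rewrite (ks_stable kK).
  have [->|xb'] := eqVneq x b'; first by rewrite adjC.
  by rewrite (ks_clique kK xK bK xb') in xb.
move=> xa xb; have [aK'|aK'] := boolP (a \in K'); first exact: half.
have [bK'|bK'] := boolP (b \in K'); first by rewrite adjC half.
exact: ks_stable kK' _ _.
Qed.

Lemma swing_adj_sub g w w' x : swing g w -> adj g w w' -> adj g w x -> x != w' ->
  adj g w' x.
Proof. by move=> sw ww' wx xw'; rewrite adjC (ks_clique sw) ?inE. Qed.

Lemma swing_nadj_sub g w w' x : swing g w -> adj g w w' = false -> adj g w' x ->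
  adj g w x.
Proof.
move=> sw ww' w'x; apply: contraTT w'x => wx.
by rewrite (ks_stable sw) // inE ?ww'.
Qed.

(** Let [a] and [b] be adjacent swing vertices. A swing vertex [c] not adjacent to [a] would be
    adjacent to [b], hence to [a], because the neighborhood of [b] is a clique. So all other swing
    vertices are neighbors of [a], and these form a clique. *)
Lemma swings_stable g : clique g (swings g) = false -> stable g (swings g).
Proof.
move=> nc; apply/stableP => a b; rewrite !inE => sa sb; apply: contraFF nc => ab.
have key c : swing g c -> c != a -> adj g c a.
  move=> sc ca; apply: contraT => /negbTE nca.
  have cb : adj g c b by apply: swing_nadj_sub ab.
  by rewrite -nca; apply: (swing_adj_sub sb); rewrite 1?adjC // eq_sym.
apply/cliqueP => x y; rewrite !inE => sx sy xy.
have [E|xa] := eqVneq x a; first by rewrite E adjC key // -E eq_sym.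
have [->|ya] := eqVneq y a; first by rewrite key // eq_sym.
by apply: (@swing_adj_sub _ a) => //; rewrite 1?adjC ?key // eq_sym.
Qed.

(* The swing vertices form a clique or a stable set. Call a splitting
   neutral if it puts them all on that same side; every other splitting
   has exactly one of them on the opposite side, which identifies it. *)
Definition exceptional g K : {set I} :=
  if clique g (swings g) then swings g :\: K else swings g :&: K.

(** A vertex on which the two splittings differ is a swing vertex by [swing_diff], and its adjacency
    to [w] then contradicts the clique or stable structure of the swing vertices. *)
Lemma exceptionalE g K w : ks g K -> w \in exceptional g K ->
  K = if clique g (swings g) then nbh g w else w |: nbh g w.
Proof.
move=> kK; rewrite /exceptional; case: ifP => [/cliqueP sc|/swings_stable/stableP ss];
  rewrite !inE; last first.
  case/andP=> sw wK; apply/setP => x; rewrite !inE.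
  have [->//|xw /=] := eqVneq x w; apply/idP/idP => [xK|wx].
    by apply: ks_clique kK _ _ _; rewrite // eq_sym.
  apply: contraT => xK.
  have sx : swing g x.
    by apply: (swing_diff (swing_ks_nbh1 sw) kK) xK; rewrite !inE wx orbT.
  by rewrite ss ?inE in wx.
case/andP=> wK sw; apply/setP => x; rewrite !inE; apply/idP/idP => [xK|wx]; last first.
  by apply: contraTT wx => xK; rewrite (ks_stable kK).
apply: contraT => wx.
have sx : swing g x by apply: (swing_diff kK sw) xK _; rewrite inE.
have xw : w != x by apply: contraNneq wK => ->.
by rewrite sc ?inE in wx.
Qed.

Lemma exceptional_uniq g K w w' : ks g K ->
  w \in exceptional g K -> w' \in exceptional g K -> w = w'.
Proof.
move=> kK wK w'K; have := exceptionalE kK wK; move: wK w'K; rewrite /exceptional.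
case: ifP => [/cliqueP sc|/swings_stable/stableP ss]; rewrite !inE.
  move=> /andP[wK sw] /andP[w'K sw'] KE; apply: contraNeq w'K => ww'.
  by rewrite KE inE sc ?inE.
move=> /andP[sw wK] /andP[sw' w'K] KE; move: w'K.
by rewrite KE !inE ss ?inE ?orbF // => /eqP.
Qed.

(** A vertex of [K] outside [K'] is a swing vertex; it is exceptional for [K'] if the swing vertices
    form a clique, and for [K] otherwise. *)
Lemma neutral_sub g K K' : ks g K -> ks g K' ->
  exceptional g K = set0 -> exceptional g K' = set0 -> K \subset K'.
Proof.
move=> kK kK' eK eK'; apply/subsetP => x xK; apply: contraT => xK'.
have sx := swing_diff kK kK' xK xK'; move: eK eK'; rewrite /exceptional.
case: ifP => _ /setP/(_ x) + /setP/(_ x); rewrite !inE sx xK //.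
by rewrite xK'.
Qed.

Lemma neutral_uniq g K K' : ks g K -> ks g K' ->
  exceptional g K = set0 -> exceptional g K' = set0 -> K = K'.
Proof.
by move=> kK kK' eK eK'; apply/eqP; rewrite eqEsubset; apply/andP; split; apply: (@neutral_sub g).
Qed.

Lemma exceptional_ex g w : swing g w -> exists K, ks g K /\ w \in exceptional g K.
Proof.
move=> sw; rewrite /exceptional; case: (clique g (swings g)).
  by exists (nbh g w); split=> //; rewrite !inE adjxx sw.
by exists (w |: nbh g w); split; [apply: swing_ks_nbh1|rewrite !inE sw eqxx].
Qed.

(** Without swing vertices every splitting is neutral. Otherwise a swing vertex [w] is put on the
    side of the others: its neighborhood contains all of them in the clique case and none in the
    stable case. *)
Lemma neutral_ex g : is_split g -> exists K, ks g K /\ exceptional g K = set0.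
Proof.
move=> /existsP[K0 kK0]; have [s0|[w sw]] := set_0Vmem (swings g).
  by exists K0; rewrite /exceptional s0 set0D set0I if_same.
rewrite inE in sw; rewrite /exceptional; case sc: (clique g (swings g)).
  move/cliqueP: sc => sc; exists (w |: nbh g w); split; first exact: swing_ks_nbh1.
  apply/setP => x; rewrite !inE; apply/negbTE; rewrite negb_and negbK.
  have [//|xw /=] := eqVneq x w; rewrite orbC -implybE.
  by apply/implyP => sx; rewrite sc ?inE 1?eq_sym.
move/swings_stable/stableP: sc => ss.
exists (nbh g w); split=> //.
apply/setP => x; rewrite !inE; apply/negbTE/negP => /andP[sx].
by rewrite ss ?inE.
Qed.
End GraphTheory.

(** * Invariance of splittings and swing vertices under relabelling *)

Section RelabelTheory.
Variables (I J : finType) (f : bij I J).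
Implicit Types (g : graph I) (K : {set I}).

Lemma mem_imset_bij K y : (y \in f @: K) = (binv f y \in K).
Proof. by rewrite -{1}(binvK f y) mem_bij_imset. Qed.

Lemma binv_eq x y : (binv f x == binv f y) = (x == y).
Proof. exact: inj_eq (can_inj (binvK f)) _ _. Qed.

Lemma relabel_ks g K : ks g K -> ks (relabel f g) (f @: K).
Proof.
move=> /ksP kK; apply/ksP => x y; rewrite !mem_imset_bij adj_relabel -binv_eq.
exact: kK.
Qed.

Lemma relabel_nbh g w : nbh (relabel f g) (f w) = f @: nbh g w.
Proof. by apply/setP => x; rewrite mem_imset_bij !inE adj_relabel bfunK. Qed.

Lemma relabel_swing g w : swing g w -> swing (relabel f g) (f w).
Proof. by rewrite /swing relabel_nbh; apply: relabel_ks. Qed.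

Lemma relabel_clique g K : clique g K -> clique (relabel f g) (f @: K).
Proof.
move=> /cliqueP cK; apply/cliqueP => x y; rewrite !mem_imset_bij adj_relabel -binv_eq.
exact: cK.
Qed.
End RelabelTheory.

Lemma relabelK (I J : finType) (f : bij I J) g : relabel (inv_bij f) (relabel f g) = g.
Proof.
rewrite -relabel_comp -[RHS]relabel_id; congr relabel.
by apply: bij_eq => x /=; rewrite bfunK.
Qed.

Lemma imset_bijK (I J : finType) (f : bij I J) (K : {set I}) : inv_bij f @: (f @: K) = K.
Proof. by apply/setP => x; rewrite !mem_imset_bij /= bfunK. Qed.

Lemma relabel_swings (I J : finType) (f : bij I J) g :
  swings (relabel f g) = f @: swings g.
Proof.
apply/setP => x; rewrite mem_imset_bij !inE; apply/idP/idP.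
  by move/(relabel_swing (inv_bij f)); rewrite relabelK.
by move/(relabel_swing f); rewrite binvK.
Qed.

Lemma relabel_exceptional (I J : finType) (f : bij I J) g (K : {set I}) :
  exceptional (relabel f g) (f @: K) = f @: exceptional g K.
Proof.
have cE : clique (relabel f g) (f @: swings g) = clique g (swings g).
  apply/idP/idP; last exact: relabel_clique.
  by move/(relabel_clique (inv_bij f)); rewrite relabelK imset_bijK.
apply/setP => x; rewrite mem_imset_bij /exceptional relabel_swings cE.
by case: ifP => _; rewrite 2!inE !mem_imset_bij -?in_setC; rewrite !inE.
Qed.

(** * The species of graphs with a splitting and of graphs with a swing vertex *)

Definition ks_struct (I : finType) : finType :=
  {gK : graph I * {set I} | ks gK.1 gK.2}.

Definition ks_transport (I J : finType) (f : bij I J) (x : ks_struct I) : ks_struct J :=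
  exist (fun gK => ks gK.1 gK.2) (relabel f (val x).1, f @: (val x).2)
    (relabel_ks f (valP x)).

Lemma ks_transport_id (I : finType) (x : ks_struct I) : ks_transport (id_bij I) x = x.
Proof.
by apply: val_inj; rewrite /= relabel_id [in imset _ _]imset_id -surjective_pairing.
Qed.

Lemma ks_transport_comp (I J K : finType) (f : bij I J) (g : bij J K) (x : ks_struct I) :
  ks_transport (comp_bij f g) x = ks_transport g (ks_transport f x).
Proof. by apply: val_inj; rewrite /= relabel_comp -imset_comp. Qed.

Definition KS : species := Species ks_transport_id ks_transport_comp.

Definition swing_struct (I : finType) : finType :=
  {gw : graph I * I | swing gw.1 gw.2}.

Definition swing_transport (I J : finType) (f : bij I J) (x : swing_struct I) :
    swing_struct J :=
  exist (fun gw => swing gw.1 gw.2) (relabel f (val x).1, f (val x).2)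
    (relabel_swing f (valP x)).

Lemma swing_transport_id (I : finType) (x : swing_struct I) :
  swing_transport (id_bij I) x = x.
Proof. by apply: val_inj; rewrite /= relabel_id -surjective_pairing. Qed.

Lemma swing_transport_comp (I J K : finType) (f : bij I J) (g : bij J K)
    (x : swing_struct I) :
  swing_transport (comp_bij f g) x = swing_transport g (swing_transport f x).
Proof. by apply: val_inj; rewrite /= relabel_comp. Qed.

Definition SW : species := Species swing_transport_id swing_transport_comp.

(** * The isomorphism between [BC] and [S + X * BC] *)

Lemma BC_KS : siso BC KS.
Proof.
(* The green vertices become the clique part. In the other direction, the edges inside the clique
   part are deleted. *)
pose R (I : finType) (x : BC I) (y : KS I) :=
  (val y).2 = [set v | (val x).2 v] /\
  forall u v, adj (val y).1 u v =
    (u != v) && (adj (val x).1 u v || ((val x).2 u && (val x).2 v)).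
apply: (@siso_rel _ _ R) => [I [[g c] gc]|I [[h K] hK]|I x [[h K] hK] [[h' K'] hK']|
    I [[g c] gc] [[g' c'] gc'] y|I J f x y].
- have [|h hE] := @graph_of_rel I (fun u v => adj g u v || (c u && c v)).
    by move=> u v; rewrite adjC andbC.
  have hK : ks h [set v | c v].
    apply/ksP => u v; rewrite !inE hE; split=> [-> -> ->|]; first by rewrite orbT.
    move=> /negbTE cu /negbTE cv; rewrite cu orbF; apply/negbTE; rewrite negb_and orbC.
    by have := forallP (forallP gc u) v; rewrite /= cu cv implybF => ->.
  by exists (exist (fun gK => ks gK.1 gK.2) (h, [set v | c v]) hK); split.
- have [|g gE] := @graph_of_rel I (fun u v => adj h u v && ~~ ((u \in K) && (v \in K))).
    by move=> u v; rewrite adjC [(u \in K) && _]andbC.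
  pose c := [ffun v => v \in K].
  have gc : is_bicoloring g c.
    apply/forallP => u; apply/forallP => v; rewrite !ffunE; apply/implyP.
    rewrite gE => /and3P[_ uv].
    have [uK|uK] := boolP (u \in K); have [vK|vK] := boolP (v \in K) => //.
    by rewrite (ks_stable hK) in uv.
  exists (exist (fun hc => is_bicoloring hc.1 hc.2) (g, c) gc); split=> /=.
    by apply/setP => v; rewrite inE ffunE.
  move=> u v; rewrite !ffunE gE; have [->|uv /=] := eqVneq u v; first exact: adjxx.
  have [uK|] := boolP (u \in K); have [vK|] := boolP (v \in K); rewrite /= ?andbT ?andbF ?orbF ?orbT //.
  exact: ks_clique hK _ _ _.
- move=> [/= KE hE] [/= KE' h'E]; apply: val_inj; rewrite /= KE KE'; congr pair.
  by apply: graph_ext => u v; rewrite hE h'E.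
- move=> [/= KE hE] [/= KE' hE']; apply: val_inj.
  have cc' : c = c'.
    by apply/ffunP => v; have /setP/(_ v) := KE'; rewrite KE !inE.
  rewrite /= -cc' in gc' hE' *; congr pair; apply: graph_ext => u v.
  have := hE u v; rewrite hE'; have [->|uv /=] := eqVneq u v; first by rewrite !adjxx.
  have := forallP (forallP gc u) v; have := forallP (forallP gc' u) v; rewrite /=.
  by case: (c u); case: (c v); rewrite /= ?implybF ?orbF ?orbT // => /negbTE-> /negbTE->.
- move=> [KE hE]; split=> [|u v] /=.
    by rewrite KE; apply/setP => v; rewrite mem_imset_bij !inE ffunE.
  by rewrite !adj_relabel hE !ffunE binv_eq.
Qed.

Lemma KS_split : siso KS (sadd SG SW).
Proof.
(* A neutral splitting is forgotten, while any other splitting is replaced by its unique exceptional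
   vertex. *)
pose R (I : finType) (x : KS I) (y : sadd SG SW I) := match y with
  | inl h => val h = (val x).1 /\ exceptional (val x).1 (val x).2 = set0
  | inr hw => (val hw).1 = (val x).1 /\ (val hw).2 \in exceptional (val x).1 (val x).2
  end.
have exc_swing (I : finType) (g : graph I) K w : w \in exceptional g K -> swing g w.
  by rewrite /exceptional; case: ifP => _; rewrite !inE => /andP[].
apply: (@siso_rel _ _ R) => [I [[g K] gK]|I [[h sh]|[[h w] sw]]|
    I [[g K] gK] [[h sh]|[[h w] sw]] [[h' sh']|[[h' w'] sw']]|
    I [[g K] gK] [[g' K'] gK'] [[h sh]|[[h w] sw]]|I J f [[g K] gK] [[h sh]|[[h w] sw]]];
  rewrite /R /=.
- have [e0|[w we]] := set_0Vmem (exceptional g K).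
    have sg : is_split g by apply/existsP; exists K.
    by exists (inl (exist (@is_split I) g sg)).
  by exists (inr (exist (fun gw => swing gw.1 gw.2) (g, w) (exc_swing _ _ _ _ we))).
- have [K [kK eK]] := neutral_ex sh.
  by exists (exist (fun gK => ks gK.1 gK.2) (h, K) kK).
- have [K [kK eK]] := exceptional_ex sw.
  by exists (exist (fun gK => ks gK.1 gK.2) (h, K) kK).
- by move=> [hg _] [h'g _]; congr inl; apply: val_inj; rewrite /= hg.
- by move=> [_ ->] [_]; rewrite inE.
- by move=> [_ +] [_ e0]; rewrite e0 inE.
- move=> [hg we] [h'g w'e]; congr inr; apply: val_inj; rewrite /= hg h'g; congr pair.
  exact: exceptional_uniq gK we w'e.
- move=> [hg e0] [hg' e0']; apply: val_inj; rewrite /= -hg -hg' in gK gK' e0 e0' *.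
  by congr pair; apply: neutral_uniq gK gK' e0 e0'.
- move=> [hg we] [hg' we']; apply: val_inj; rewrite /= -hg -hg' in gK gK' we we' *.
  by congr pair; rewrite (exceptionalE gK we) -(exceptionalE gK' we').
- by move=> [-> e0]; rewrite relabel_exceptional e0 imset0.
- by move=> [-> we]; rewrite relabel_exceptional mem_bij_imset.
Qed.

Lemma setC1_cases (I : finType) (w i : I) :
  i = w \/ exists u : part (~: [set w]), i = val u.
Proof.
have [->|iw] := eqVneq i w; [by left|right].
have iV : i \in ~: [set w] by rewrite !inE.
by exists (exist (fun i => i \in ~: [set w]) i iV).
Qed.

Lemma SW_XKS : siso (smul sX KS) SW.
Proof.
(* The singleton [V] holds the swing vertex [w]; the graph on the complement is the induced one, and
   the clique part of its splitting is the neighborhood of [w]. *)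
pose R (I : finType) (x : smul sX KS I) (y : SW I) :=
  let: existT V (_, hK) := x in
  [/\ (val y).2 \in V,
    forall u v : part (~: V), adj (val y).1 (val u) (val v) = adj (val hK).1 u v &
    forall v : part (~: V), adj (val y).1 (val y).2 (val v) = (v \in (val hK).2)].
have one (I : finType) (V : {set I}) (a : sX (part V)) w : w \in V -> V = [set w].
  move=> wV; apply/esym/eqP; rewrite eqEcard sub1set wV cards1 -(card_part V).
  by rewrite (eqP (valP a)).
apply: (@siso_rel _ _ R) => [I [V [a [[h K] hK]]]|I [[g w] sw]|
    I [V [a [[h K] hK]]] [[g w] sw] [[g' w'] sw']|
    I [V [a [[h K] hK]]] [V' [a' [[h' K'] hK']]] [[g w] sw]|
    I J f [V [a [[h K] hK]]] [[g w] sw]]; rewrite /R /=.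
- have [w wV] : exists w, w \in V.
    by apply/card_gt0P; rewrite -card_part (eqP (valP a)).
  move: (one _ _ a _ wV) => VE; subst V.
  pose inK (i : I) := if insub i is Some u then (u : part (~: [set w])) \in K else false.
  (* The value [None] of [insub] marks [w], so [r] extends [h] by joining [w] exactly to the
     vertices of [K]. *)
  pose r i j := match insub i, insub j with
    | Some u, Some v => adj h (u : part (~: [set w])) (v : part (~: [set w]))
    | None, Some v => v \in K | Some u, None => u \in K | None, None => false end.
  have [|g gE] := @graph_of_rel I r.
    by move=> i j; rewrite /r; case: insub => [u|]; case: insub => [v|] //; apply: adjC.
  have insw : insub w = None :> option (part (~: [set w])).
    by rewrite insubF // !inE eqxx.
  have neq (v : part (~: [set w])) : w != val v.
    by have := valP v; rewrite !inE eq_sym.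
  have gw (v : part (~: [set w])) : adj g w (val v) = (v \in K).
    by rewrite gE neq /r insw valK.
  have gv (u v : part (~: [set w])) : adj g (val u) (val v) = adj h u v.
    rewrite gE /r !valK; have [/val_inj->|//] := eqVneq (val u) (val v).
    by rewrite adjxx.
  have sw : swing g w.
    apply/ksP => i j; rewrite !inE.
    have [->|[u ->]] := setC1_cases w i; have [->|[v ->]] := setC1_cases w j; rewrite ?adjxx ?gw //.
    + by split=> // _ /negbTE.
    + by rewrite adjC gw; split=> // /negbTE.
    + rewrite gv (inj_eq val_inj); exact: (ksP _ _ hK).
  by exists (exist (fun gw => swing gw.1 gw.2) (g, w) sw).
- have aP : #|part [set w]| == 1 by rewrite card_part cards1.
  have [|h hE] := @graph_of_rel (part (~: [set w])) (fun u v => adj g (val u) (val v)).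
    by move=> u v; rewrite adjC.
  pose K := [set v : part (~: [set w]) | adj g w (val v)].
  have {}hE u v : adj h u v = adj g (val u) (val v).
    by rewrite hE; have [->|//] := eqVneq u v; rewrite adjxx.
  have hK : ks h K.
    apply/ksP => u v; rewrite !inE hE -(inj_eq val_inj).
    by have := ksP _ _ sw (val u) (val v); rewrite !inE.
  exists (existT _ [set w] (exist (fun=> #|part [set w]| == 1) tt aP,
    exist (fun gK => ks gK.1 gK.2) (h, K) hK)).
  by split=> [|u v|v]; rewrite ?inE ?hE.
- move=> [wV gE gK] [w'V g'E g'K]; move: (one _ _ a _ wV) => VE; subst V.
  have {w'V} /set1P ww' := w'V; subst w'; apply: val_inj; congr pair.
  apply: graph_ext => i j.
  have [->|[u ->]] := setC1_cases w i; have [->|[v ->]] := setC1_cases w j.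
  + by rewrite !adjxx.
  + by rewrite gK g'K.
  + by rewrite adjC gK adjC g'K.
  + by rewrite gE g'E.
- move=> [wV gE gK] [wV' g'E g'K].
  move: (one _ _ a _ wV) (one _ _ a' _ wV') => VE VE'; subst V; subst V'.
  congr existT; congr pair; first exact: of_size_irr.
  apply: val_inj; congr pair; last by apply/setP => v; rewrite -gK g'K.
  by apply: graph_ext => u v; rewrite -gE g'E.
- have val_inv (v : part (~: (f @: V))) :
      binv f (val v) = val (binv (bij_on (mem_bij_imsetC f V)) v) by [].
  move=> [wV gE gK]; split=> [|u v|v]; first by rewrite mem_bij_imset.
  + by rewrite !adj_relabel !val_inv gE.
  + rewrite adj_relabel bfunK val_inv gK; apply/esym.
    exact: (mem_imset_bij (bij_on (mem_bij_imsetC f V))).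
Qed.

Theorem theorem3p2 :
  veq BC (vmul (vinv (vsub s1 sX) vunit_1X) SG).
Proof.
apply: veq_div_1X.
(* [BC] is [KS], which is [S + SW]; here [SW] is [X * KS], and therefore [X * BC]. *)
apply: siso_trans BC_KS _; apply: siso_trans KS_split _.
apply: sadd_cong (siso_refl _) _; apply: siso_trans (siso_sym SW_XKS) _.
exact: smul_cong (siso_refl _) (siso_sym BC_KS).
Qed.
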